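(* Let $G$ be a bipartite graph. For every edge $xy\in E(G)$, let $N_x=N(x)\setminus\{y\}$, $N_y=N(y)\setminus\{x\}$, and let $H_{xy}=G[N_x,N_y]$ be the bipartite subgraph of $G$ consisting of the edges between $N_x$ and $N_y$. Then $$\kappa_{\mathrm{LLY}}(x,y)=2\min_{U\subseteq N_y}\left(\frac{|N_{H_{xy}}(U)|+1}{d_x}-\frac{|U|}{d_y}\right),$$ where $U$ ranges over all subsets of $N_y$ (including $\emptyset$) and $N_{H_{xy}}(U)\subseteq N_x$ is the set of vertices of $N_x$ adjacent to at least one vertex of $U$.
   Context: All graphs are finite and simple. $N(x)$ is the set of neighbors of $x$ in $G$. Let $\rho$ denote graph distance and $d_x$ the degree of a vertex $x$ in $G$. For probability measures $\mu_1,\mu_2$ on $V(G)$, the $L^1$-Wasserstein distance is $W(\mu_1,\mu_2)=\inf_\pi\sum_{u,v\in V}\rho(u,v)\pi(u,v)$, the infimum over $\pi:V\times V\to[0,1]$ with $\sum_v\pi(u,v)=\mu_1(u)$ for all $u$ and $\sum_u\pi(u,v)=\mu_2(v)$ for all $v$. For $\alpha\in[0,1]$ and a vertex $x$, $\mu_x^\alpha$ is the measure with $\mu_x^\alpha(x)=\alpha$, $\mu_x^\alpha(z)=\frac{1-\alpha}{d_x}$ if $z$ is adjacent to $x$, and $0$ otherwise. For an edge $xy$ (so $\rho(x,y)=1$), $\kappa_\alpha(x,y)=1-W(\mu_x^\alpha,\mu_y^\alpha)$ and the Lin--Lu--Yau curvature is $\kappa_{\mathrm{LLY}}(x,y)=\lim_{\alpha\to1^-}\frac{\kappa_\alpha(x,y)}{1-\alpha}$.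 (For edges, all the measures involved are supported in one connected component.) *)

(* Defs.v *)
From HB Require Import structures.
From mathcomp Require Import all_boot all_order all_algebra.
From mathcomp Require Import all_classical all_reals all_analysis.

Set Implicit Arguments.
Unset Strict Implicit.
Unset Printing Implicit Defensive.

Import Order.TTheory GRing.Theory Num.Theory.
Import numFieldNormedType.Exports.

Local Open Scope classical_set_scope.
Local Open Scope ring_scope.

(* A finite simple graph is a symmetric irreflexive relation [e] on a finite
   type [T] of vertices. *)

Definition bipartite (T : finType) (e : rel T) : Prop :=
  exists A : {set T}, forall u v : T, e u v -> (u \in A) != (v \in A).

Definition nbr (T : finType) (e : rel T) (x : T) : {set T} :=
  [set z | e x z]%SET.

Definition degree (T : finType) (e : rel T) (x : T) : nat := #|nbr e x|.

(* [path e u p] makes [u :: p] a walk with [size p] edges; the infimum of the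
   empty set is [+oo], so vertices in distinct components are at distance
   [+oo]. *)
Definition graph_dist (R : realType) (T : finType) (e : rel T) (u v : T)
    : \bar R :=
  ereal_inf [set ((size p)%:R)%:E | p in
             [set p : seq T | path e u p /\ last u p = v]].

Definition coupling (R : realType) (T : finType) (mu nu : T -> R)
    (pi : T -> T -> R) : Prop :=
  [/\ forall u v, 0 <= pi u v <= 1,
      forall u, \sum_v pi u v = mu u
    & forall v, \sum_u pi u v = nu v].

(* In [\bar R], [+oo * 0 = 0]: pairs at infinite distance that carry no mass
   do not contribute to the cost. *)
Definition transport_cost (R : realType) (T : finType) (e : rel T)
    (pi : T -> T -> R) : \bar R :=
  (\sum_u \sum_v graph_dist R e u v * (pi u v)%:E)%E.

Definition wasserstein (R : realType) (T : finType) (e : rel T)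
    (mu nu : T -> R) : \bar R :=
  ereal_inf [set transport_cost e pi | pi in coupling mu nu].

Definition lazy_measure (R : realType) (T : finType) (e : rel T) (alpha : R)
    (x z : T) : R :=
  if z == x then alpha
  else if e x z then (1 - alpha) / (degree e x)%:R
  else 0.

Definition kappa (R : realType) (T : finType) (e : rel T) (alpha : R)
    (x y : T) : \bar R :=
  (1 - wasserstein e (lazy_measure e alpha x) (lazy_measure e alpha y))%E.

Definition kappa_ratio (R : realType) (T : finType) (e : rel T) (x y : T)
    (alpha : R) : \bar R :=
  (kappa e alpha x y * ((1 - alpha)^-1)%:E)%E.

(* [lim] is meaningful only when the limit exists, that is, together with
   [cvg (kappa_ratio e x y alpha @[alpha --> 1^'-])]. *)
Definition kappa_LLY (R : realType) (T : finType) (e : rel T) (x y : T)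
    : \bar R :=
  lim (kappa_ratio e x y alpha @[alpha --> (1 : R)^'-]).

Definition between (T : finType) (e : rel T) (A B : {set T}) : rel T :=
  fun u v => e u v &&
    ((u \in A) && (v \in B) || (u \in B) && (v \in A)).

Definition nbr_minus (T : finType) (e : rel T) (x y : T) : {set T} :=
  (nbr e x :\ y)%SET.

Definition H_edge (T : finType) (e : rel T) (x y : T) : rel T :=
  between e (nbr_minus e x y) (nbr_minus e y x).

Definition nbr_H (T : finType) (e : rel T) (x y : T) (U : {set T}) : {set T} :=
  [set z in nbr_minus e x y | [exists u in U, H_edge e x y u z]]%SET.

(* Main.v *)
Require Import Defs.
From HB Require Import structures.
From mathcomp Require Import all_boot all_order all_algebra.
From mathcomp Require Import all_classical all_reals all_analysis.
From mathcomp Require Import zify ring lra.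

(* The W-distance equals 1 - 2(1 - alpha) m for every alpha in [1/2, 1), where m
   is the minimum over U, so the ratio is constant near 1.
   Lower bound: for each U an integer-valued Kantorovich potential gives
   1 - 2(1 - alpha)(value at U); bipartiteness makes it 1-Lipschitz.
   Upper bound: move mass from N_x to N_y along the edges of H as much as
   possible and route the rest through the edge xy. By max-flow min-cut, in the
   form of Hall's theorem with capacities, the part of N_y that cannot be
   reached through H has mass at most (1 - alpha)(1/d_x - m). *)

Set Implicit Arguments.
Unset Strict Implicit.
Unset Printing Implicit Defensive.

Import Order.TTheory GRing.Theory Num.Theory.
Import numFieldNormedType.Exports.

Local Open Scope classical_set_scope.
Local Open Scope ring_scope.

(** * Hall's theorem with integer supplies and demands *)

Section TransportHall.
Import boot.finset.
Variables (X Y : finType) (r : X -> Y -> bool).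
Local Open Scope nat_scope.
Local Open Scope set_scope.

Definition suppliers (U : {set Y}) : {set X} := [set u | [exists v in U, r u v]].

Lemma suppliersP (U : {set Y}) u :
  reflect (exists2 v, v \in U & r u v) (u \in suppliers U).
Proof. by rewrite inE; apply: exists_inP. Qed.

Lemma suppliersU (U V : {set Y}) :
  suppliers (U :|: V) = suppliers U :|: suppliers V.
Proof.
apply/setP=> u; rewrite in_setU; apply/suppliersP/orP.
  by case=> v /setUP[vU|vV] ruv; [left|right]; apply/suppliersP; exists v.
by case=> /suppliersP[v vUV ruv]; exists v; rewrite // in_setU vUV ?orbT.
Qed.

(** Only an inclusion: one vertex may supply [U] and [V] through different elements. Together with
    [suppliersU] it makes the total supply available to [U] submodular in [U]. *)
Lemma suppliersI (U V : {set Y}) :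
  suppliers (U :&: V) \subset suppliers U :&: suppliers V.
Proof.
apply/fintype.subsetP=> u /suppliersP[v /setIP[vU vV] ruv].
by rewrite in_setI; apply/andP; split; apply/suppliersP; exists v.
Qed.

(** Subtraction in [nat] truncates; [0 < f i] ensures that a unit really is removed at [i]. *)
Lemma sum_decr_at (I : finType) (f : I -> nat) (i : I) (A : {set I}) :
  0 < f i -> \sum_(j in A) (f j - (j == i)) + (i \in A) = \sum_(j in A) f j.
Proof.
move=> fi_gt0; have [iA|iA] := boolP (i \in A); last first.
  rewrite addn0; apply: eq_bigr => j jA.
  by case: eqP => [ji|_]; [rewrite -ji jA in iA | rewrite subn0].
rewrite (bigD1 i) //= [RHS](bigD1 i) //= eqxx.
rewrite (eq_bigr f) => [|j /andP[_ /negbTE ->]]; last by rewrite subn0.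
by lia.
Qed.

Lemma sum_setUI (I : finType) (f : I -> nat) (A B : {set I}) :
  \sum_(i in A :|: B) f i + \sum_(i in A :&: B) f i =
  \sum_(i in A) f i + \sum_(i in B) f i.
Proof.
rewrite (big_setID A (A := A :|: B)) /= (big_setID A (A := B)) /=.
by rewrite setUK setDUl setDv set0U (setIC B A); lia.
Qed.

Lemma sum_subset (I : finType) (f : I -> nat) (A B : {set I}) :
  A \subset B -> \sum_(i in A) f i <= \sum_(i in B) f i.
Proof.
move=> AB; rewrite [leqRHS](big_setID A) /= (setIidPr AB).
exact: leq_addr.
Qed.

(* Tight sets avoiding [v] are closed under union by submodularity; if no unit
   of supply could be sent to [v], adding [v] to the largest such set would
   violate Hall's condition. *)
Lemma transport_hall (a : X -> nat) (b : Y -> nat) :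
  (forall U : {set Y}, \sum_(v in U) b v <= \sum_(u in suppliers U) a u) ->
  exists g : X -> Y -> nat,
    [/\ forall u v, 0 < g u v -> r u v,
        forall u, \sum_v g u v <= a u
      & forall v, \sum_u g u v = b v].
Proof.
(* Induction on the total demand: each round ships one unit and lowers [a] and [b] at one point
   each. *)
have [n] := ubnP (\sum_v b v); elim: n => // n IHn in a b *.
rewrite ltnS => le_b_n hall.
have [/existsP[v bv_gt0]|] := boolP [exists v, 0 < b v]; last first.
  rewrite negb_exists => /forallP b0.
  exists (fun _ _ => 0); split=> // [u|v]; rewrite big1 //.
  by apply/esym/eqP; rewrite -leqn0 leqNgt.
(* These are the obstructions: taking a unit from a supplier of such a [U] and sending it to [v]
   would break Hall's condition at [U]. *)
pose tight (U : {set Y}) :=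
  (\sum_(w in U) b w == \sum_(u in suppliers U) a u) && (v \notin U).
have [/existsP[u /and3P[ruv au_gt0 /forallP notight]]|] :=
  boolP [exists u, [&& r u v, 0 < a u &
                     [forall U, tight U ==> (u \notin suppliers U)]]].
- pose a' z := a z - (z == u); pose b' w := b w - (w == v).
  have sum_b' : \sum_w b' w < n.
    have sumT f : \sum_w f w = \sum_(w in [set: Y]) f w.
      by apply: eq_bigl => w; rewrite in_setT.
    by apply: leq_trans le_b_n; rewrite !sumT -(sum_decr_at _ bv_gt0) in_setT addn1.
  have hall' (U : {set Y}) : \sum_(w in U) b' w <= \sum_(z in suppliers U) a' z.
    have := hall U; rewrite -(sum_decr_at _ bv_gt0) -(sum_decr_at _ au_gt0).
    have [vU|vU] := boolP (v \in U).
      have -> : u \in suppliers U by apply/suppliersP; exists v.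
      by rewrite leq_add2r.
    (* Either the inequality at [U] is strict and absorbs the lost unit, or [U] is tight and [u]
       does not supply it. *)
    have := notight U; rewrite /tight vU andbT -(sum_decr_at _ bv_gt0).
    rewrite -(sum_decr_at _ au_gt0) (negbTE vU) addn0 /a' /b'.
    by case: (u \in suppliers U) => /=; lia.
  have [g [g_r g_a g_b]] := IHn a' b' sum_b' hall'.
  exists (fun z w => g z w + ((z == u) && (w == v))); split=> [z w|z|w].
  + by case: andP => [[/eqP-> /eqP->] //|_]; rewrite addn0; apply: g_r.
  + rewrite big_split /= [X in _ + X](bigD1 v) //= eqxx.
    rewrite [X in _ + (_ + X)]big1 => [|w /negbTE ->]; last by rewrite andbF.
    by have := g_a z; rewrite /a' andbT; case: eqP => [->|_] /=; lia.
  rewrite big_split /= [X in _ + X](bigD1 u) //= eqxx.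
  rewrite [X in _ + (_ + X)]big1 => [|z /negbTE ->] //=; rewrite g_b /b'.
  by case: eqP => [->|_] /=; lia.
rewrite negb_exists => /forallP blocked.
pose M := \bigcup_(U | tight U) U.
have /andP[/eqP tM vM] : tight M.
  rewrite /M; apply: (big_ind tight) => // [|U V /andP[/eqP tU vU] /andP[/eqP tV vV]].
    rewrite /tight in_set0 andbT big_set0 big_pred0 // => u.
    by apply/suppliersP => -[w]; rewrite in_set0.
  rewrite /tight in_setU negb_or vU vV andbT eqn_leq hall /=.
  have := sum_setUI a (suppliers U) (suppliers V).
  have := sum_setUI b U V; have := hall (U :&: V).
  by have := sum_subset a (suppliersI U V); rewrite suppliersU; lia.
have := hall (v |: M); rewrite big_setU1 //= suppliersU.
(* A supplier of [v] with positive supply is blocked by a tight set, hence supplies [M]. Adding [v]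
   to [M] thus adds the demand [b v > 0] but no supply. *)
suff : \sum_(u in suppliers [set v] :|: suppliers M) a u
       <= \sum_(u in suppliers M) a u by lia.
rewrite (big_setID (suppliers M)) /= setUC setUK -[leqRHS]addn0 leq_add2l.
rewrite leqn0 sum_nat_eq0; apply/forallP=> u; apply/implyP.
rewrite setDUl setDv set0U => /setDP[/suppliersP[v' /set1P-> ruv] uM].
have := blocked u; rewrite ruv /= negb_and -leqNgt leqn0.
case/orP=> // /forallPn[U]; rewrite negb_imply negbK => /andP[tU uU].
case/negP: uM; case/suppliersP: uU => w wU ruw; apply/suppliersP; exists w => //.
by apply/bigcupP; exists U.
Qed.

End TransportHall.

(** * Transport cost and weak Kantorovich duality *)

Section Distance.
Variables (R : realType) (T : finType) (e : rel T).
Implicit Types (u v : T) (c pi : T -> T -> R) (mu nu phi psi : T -> R).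

Lemma graph_dist_le_path u p :
  path e u p -> (graph_dist R e u (last u p) <= ((size p)%:R)%:E)%E.
Proof. by move=> up; apply: ereal_inf_lbound; exists p. Qed.

Lemma graph_dist_ge u v (c : R) :
  (forall p, path e u p -> last u p = v -> c <= (size p)%:R) ->
  (c%:E <= graph_dist R e u v)%E.
Proof.
move=> cP; apply: le_ereal_inf_tmp => _ [p [up upv] <-].
by rewrite lee_fin cP.
Qed.

(** Massless pairs cost nothing even at infinite distance, so a real-valued [c] has to control the
    distance only where [pi] is nonzero. *)
Lemma transport_cost_le c pi :
  (forall u v, 0 <= pi u v) ->
  (forall u v, pi u v != 0 -> (graph_dist R e u v <= (c u v)%:E)%E) ->
  (transport_cost e pi <= (\sum_u \sum_v c u v * pi u v)%:E)%E.
Proof.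
move=> pi_ge0 le_c; rewrite /transport_cost -sumEFin; apply: lee_sum => u _.
rewrite -sumEFin; apply: lee_sum => v _.
have [->|piN0] := eqVneq (pi u v) 0; first by rewrite mule0 mulr0.
by rewrite EFinM lee_wpmul2r ?lee_fin ?le_c.
Qed.

Lemma transport_cost_ge c pi :
  (forall u v, 0 <= pi u v) ->
  (forall u v, pi u v != 0 -> ((c u v)%:E <= graph_dist R e u v)%E) ->
  ((\sum_u \sum_v c u v * pi u v)%:E <= transport_cost e pi)%E.
Proof.
move=> pi_ge0 le_c; rewrite /transport_cost -sumEFin; apply: lee_sum => u _.
rewrite -sumEFin; apply: lee_sum => v _.
have [->|piN0] := eqVneq (pi u v) 0; first by rewrite mule0 mulr0.
by rewrite EFinM lee_wpmul2r ?lee_fin ?le_c.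
Qed.

(** Weak duality: integrate [phi v - psi u] against any coupling. A nonzero entry of a coupling has
    both marginals nonzero, so the Lipschitz bound is asked only between the supports. *)
Lemma wasserstein_ge_dual mu nu phi psi :
  (forall u v, mu u != 0 -> nu v != 0 ->
     ((phi v - psi u)%:E <= graph_dist R e u v)%E) ->
  ((\sum_v phi v * nu v - \sum_u psi u * mu u)%:E <= wasserstein e mu nu)%E.
Proof.
move=> lip; apply: le_ereal_inf_tmp => _ [pi [pi01 pi_mu pi_nu] <-].
have pi_ge0 u v : 0 <= pi u v by have /andP[] := pi01 u v.
have suppl u v : pi u v != 0 -> mu u != 0.
  move=> piN0; rewrite -pi_mu psumr_neq0 //; apply/hasP.
  exists v; first exact: mem_index_enum.
  by rewrite /= lt_def piN0 pi_ge0.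
have suppr u v : pi u v != 0 -> nu v != 0.
  move=> piN0; rewrite -pi_nu psumr_neq0 //; apply/hasP.
  exists u; first exact: mem_index_enum.
  by rewrite /= lt_def piN0 pi_ge0.
apply: le_trans (transport_cost_ge (c := fun u v => phi v - psi u) pi_ge0 _);
  last by move=> u v piN0; apply: lip; [exact: suppl piN0|exact: suppr piN0].
under [X in (_ <= X%:E)%E]eq_bigr do
  (under eq_bigr do rewrite mulrBl; rewrite big_split sumrN -mulr_sumr pi_mu).
rewrite big_split sumrN lee_fin lerD2r exchange_big /=.
by under [X in _ <= X]eq_bigr do rewrite -mulr_sumr pi_nu.
Qed.

Lemma sum_lazy_measure (irr_e : irreflexive e) (f : T -> R) (alpha : R) x :
  \sum_u f u * lazy_measure e alpha x u =
  f x * alpha + (1 - alpha) / (degree e x)%:R * \sum_(u in nbr e x) f u.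
Proof.
rewrite (bigD1 x) //= /lazy_measure eqxx; congr (_ + _).
rewrite mulr_sumr big_mkcond [RHS]big_mkcond; apply: eq_bigr => u _.
rewrite inE; have [->|ux] /= := eqVneq u x; first by rewrite irr_e.
by case: ifP => _; [rewrite mulrC|rewrite mulr0].
Qed.

End Distance.

(** * Lower and upper bounds for the Wasserstein distance across an edge *)

Section EdgeBounds.
Variables (R : realType) (T : finType) (e : rel T).
Hypotheses (e_sym : symmetric e) (e_irr : irreflexive e).
Variables (A : {set T}) (eA : forall u v, e u v -> (u \in A) != (v \in A)).
Variables (x y : T) (exy : e x y).

Let Nx := nbr_minus e x y.
Let Ny := nbr_minus e y x.

Let inNx u : (u \in Nx) = (u != y) && e x u. Proof. by rewrite !inE. Qed.
Let inNy u : (u \in Ny) = (u != x) && e y u. Proof. by rewrite !inE. Qed.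

(** Every edge switches colour. This parity excludes the short walks that would violate the
    Lipschitz condition. *)
Lemma bipartite_path u p : path e u p -> (last u p \in A) = (u \in A) (+) odd (size p).
Proof.
elim: p u => [|v p IHp] u /=; first by rewrite addbF.
case/andP=> euv /IHp ->; have := eA euv.
by case: (u \in A); case: (v \in A); case: (odd _).
Qed.

Lemma degree_gt0 : (0 < degree e x)%N.
Proof. by apply/card_gt0P; exists y; rewrite inE. Qed.

Lemma nbr_HE (U : {set T}) u :
  U \subset Ny -> (u \in nbr_H e x y U) = (u \in Nx) && [exists v in U, e u v].
Proof.
move=> /fintype.subsetP sU; rewrite inE -/Nx; have [uNx|//] := boolP (u \in Nx).
apply: eq_existsb => v; have [vU|//] := boolP (v \in U).
rewrite /H_edge /between -/Nx -/Ny uNx (sU _ vU) orbT andbT.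
by rewrite e_sym.
Qed.

(* The Kantorovich potential [phi] is [2] on [U], [1] on [N_H(U)] and [y],
   [0] on [x] and the rest of [N_y], and [-1] on the rest of [N_x]; it is
   1-Lipschitz because a value gap of [3] only occurs between vertices of
   opposite colours that are not adjacent. *)
Lemma wasserstein_ge_cut (alpha : R) (U : {set T}) : U \subset Ny ->
  ((1 - 2 * (1 - alpha) * ((#|nbr_H e x y U| + 1)%:R / (degree e x)%:R
      - #|U|%:R / (degree e y)%:R))%:E
   <= wasserstein e (lazy_measure e alpha x) (lazy_measure e alpha y))%E.
Proof.
move=> sU.
have xy : x != y by apply: contraTneq exy => ->; rewrite e_irr.
have xU : x \notin U by apply: contra (fintype.subsetP sU x) _; rewrite inNy eqxx.
have yU : y \notin U by apply: contra (fintype.subsetP sU y) _; rewrite inNy e_irr andbF.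
pose NU := nbr_H e x y U.
have yNU : y \notin NU by rewrite nbr_HE // inNx eqxx.
(* The potential is split by support: [phi] is read on the closed neighbourhood of [y], [psi] on
   that of [x]. *)
pose phi v : R := if v == y then 1 else if v \in U then 2 else 0.
pose psi u : R := if u == x then 0 else if u \in y |: NU then 1 else -1.
have dxN0 : (degree e x)%:R != 0 :> R by rewrite pnatr_eq0 -lt0n degree_gt0.
have sum_phi : \sum_(v in nbr e y) phi v = 2 * #|U|%:R.
  rewrite mulr_natr -sumr_const (big_setID U) /= addrC big1 ?add0r.
    apply: eq_big => [v|v /setIP[_ vU]].
      rewrite !inE; have [vU|] := boolP (v \in U); last by rewrite andbF.
      by have /(fintype.subsetP sU) := vU; rewrite inNy => /andP[_ ->].
    by rewrite /phi vU; case: eqP vU yU => [->|//] ->.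
  move=> v; rewrite !inE => /andP[vU eyv]; rewrite /phi (negbTE vU).
  by case: eqP eyv => // ->; rewrite e_irr.
have sum_psi : \sum_(u in nbr e x) psi u = 2 * (#|NU| + 1)%:R - (degree e x)%:R.
  have -> : 2 * (#|NU| + 1)%:R = \sum_(u in nbr e x) (if u \in y |: NU then 2 else 0) :> R.
    rewrite -big_mkcondr /= addnC -[1%N]/(nat_of_bool true) -yNU -cardsU1.
    rewrite mulr_natr -sumr_const.
    apply: eq_bigl => u; rewrite !inE; have [->|_] /= := eqVneq u y; first by rewrite exy.
    by rewrite andbA andbb.
  rewrite /degree -sumr_const -sumrB; apply: eq_bigr => u; rewrite inE /psi.
  case: (eqVneq u x) => [->|_ _]; first by rewrite e_irr.
  by case: ifP => _; ring.
(* The constant 1 is [alpha], from [phi y = 1], plus [1 - alpha], from the term [- degree e x] in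
   [sum_psi]. *)
have -> : 1 - 2 * (1 - alpha) * ((#|NU| + 1)%:R / (degree e x)%:R
      - #|U|%:R / (degree e y)%:R)
    = \sum_v phi v * lazy_measure e alpha y v - \sum_u psi u * lazy_measure e alpha x u.
  rewrite !sum_lazy_measure // sum_phi sum_psi /phi /psi !eqxx.
  by move: (degree e y)%:R^-1 => dyV; field.
apply: wasserstein_ge_dual => u v; rewrite /lazy_measure => suppu suppv.
have {}suppu : (u == x) || e x u by move: suppu; case: ifP => //; case: ifP; rewrite ?eqxx.
have {}suppv : (v == y) || e y v by move: suppv; case: ifP => //; case: ifP; rewrite ?eqxx.
have neq_col a b : e a b -> (b \in A) = ~~ (a \in A).
  by move/eA; case: (a \in A); case: (b \in A).
have yA := neq_col _ _ exy.
apply: graph_dist_ge => p up upv; move: (bipartite_path up); rewrite upv => par.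
have gap k : (k <= size p)%N -> phi v - psi u <= k%:R -> phi v - psi u <= (size p)%:R.
  by move=> kp /le_trans; apply; rewrite ler_nat.
have uNil : u != v -> (0 < size p)%N.
  by case: (p) upv => //= <-; rewrite eqxx.
have colu : u != x -> (u \in A) = ~~ (x \in A).
  by move: suppu; case: eqP => //= _ /neq_col.
have colv : v != y -> (v \in A) = (x \in A).
  by move: suppv; case: eqP => //= _ /neq_col ->; rewrite yA negbK.
have [vy|vy] := eqVneq v y.
  have [ux|ux] := eqVneq u x.
    apply: (gap 1%N); last by rewrite /phi /psi vy ux !eqxx subr0.
    by apply: uNil; rewrite vy ux.
  have [uNU|uNU] := boolP (u \in y |: NU).
    by apply: (gap 0%N) => //; rewrite /phi /psi vy (negbTE ux) uNU eqxx subrr.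
  (* Here [u] and [y] are distinct and of the same colour, so the walk has positive even length. *)
  apply: (gap 2%N); last by rewrite /phi /psi vy (negbTE ux) (negbTE uNU) eqxx; lra.
  have: (0 < size p)%N.
    by apply: uNil; apply: contraNneq uNU => ->; rewrite vy !inE eqxx.
  move: par; rewrite vy yA colu //.
  by case: (size p) => [|[|n]] //=; case: (x \in A).
have [vU|vU] := boolP (v \in U); last first.
  have [ux|ux] := eqVneq u x.
    by apply: (gap 0%N) => //; rewrite /phi /psi (negbTE vy) (negbTE vU) ux eqxx subrr.
  apply: (gap 1%N); last first.
    by rewrite /phi /psi (negbTE vy) (negbTE vU) (negbTE ux); case: ifP => _; lra.
  apply: uNil; apply: contraTneq isT => uv.
  by move: (colv vy); rewrite -uv colu //; case: (x \in A).
have [ux|ux] := eqVneq u x.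
  apply: (gap 2%N); last by rewrite /phi /psi (negbTE vy) vU ux eqxx; lra.
  have: (0 < size p)%N by apply: uNil; apply: contraTneq vU => <-; rewrite ux.
  move: par; rewrite ux (colv vy).
  by case: (size p) => [|[|n]] //=; case: (x \in A).
have : odd (size p).
  by move: par; rewrite (colv vy) (colu ux); case: (x \in A); case: odd.
have [uNU|uNU] := boolP (u \in y |: NU) => podd.
  apply: (gap 1%N); first by case: (size p) podd.
  by rewrite /phi /psi (negbTE vy) vU (negbTE ux) uNU; lra.
(* The length is odd, and length 1 would make [u] a neighbour of [v] in [U], putting it in [NU]. *)
apply: (gap 3%N); last first.
  by rewrite /phi /psi (negbTE vy) vU (negbTE ux) (negbTE uNU); lra.
case: p podd up upv {par gap uNil} => [|w [|w' [|w'' p]]] //= _.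
rewrite andbT => euw wv; case/negP: uNU; rewrite -{}wv in vU *.
rewrite in_setU1 nbr_HE // inNx; case: eqP => //= _.
move: suppu; rewrite (negbTE ux) /= => ->.
by apply/exists_inP; exists w.
Qed.


(* Scaled by [s], the Hall flow [g] fills [N_y] from [N_x] along edges and from
   [x] at distance 2 with the [D] missing units; whatever it does not use goes
   to [y], except for the mass [(1 - alpha) / d_y] that stays at [x]. *)
Lemma wasserstein_le_deficiency (alpha : R) (D : nat) :
  2^-1 <= alpha -> alpha <= 1 ->
  (forall U : {set T}, U \subset Ny ->
     (#|U| * degree e x <= #|nbr_H e x y U| * degree e y + D)%N) ->
  (wasserstein e (lazy_measure e alpha x) (lazy_measure e alpha y) <=
   (1 - 2 * (1 - alpha) * ((degree e x)%:R^-1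
      - D%:R / ((degree e x)%:R * (degree e y)%:R)))%:E)%E.
Proof.
move=> alpha_ge alpha_le deficient.
set dx := degree e x; set dy := degree e y.
have xy : x != y by apply: contraTneq exy => ->; rewrite e_irr.
have eyx : e y x by rewrite e_sym.
have dx_gt0 : (0 < dx)%N := degree_gt0.
have dy_gt0 : (0 < dy)%N by apply/card_gt0P; exists x; rewrite inE.
have card_Ny : #|Ny|.+1 = dy by rewrite /dy /degree [RHS](cardsD1 x) inE eyx.
have xNx : x \notin Nx by rewrite inNx e_irr andbF.
pose r u v := (u == x) || (u \in Nx) && e u v.
(* Mass is counted in units of [(1 - alpha) / (dx * dy)]: a vertex of [Nx] holds [dy] units and a
   vertex of [Ny] needs [dx]. *)
pose a u := if u == x then D else if u \in Nx then dy else 0%N.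
pose b v := if v \in Ny then dx else 0%N.
have sum_b (U : {set T}) : (\sum_(v in U) b v = #|U :&: Ny| * dx)%N.
  by rewrite /b -big_mkcondr -sum_nat_const; apply: eq_bigl => v; rewrite finset.in_setI.
have hall (U : {set T}) : (\sum_(v in U) b v <= \sum_(u in suppliers r U) a u)%N.
  (* Once [U] meets [Ny], the vertex [x] is among its suppliers and its [D] units cover the
     deficiency. *)
  rewrite sum_b; have [->|[v vUN]] := set_0Vmem (U :&: Ny); first by rewrite cards0.
  have sN : U :&: Ny \subset Ny by apply: subsetIr.
  apply: leq_trans (deficient _ sN) _.
  have : x |: nbr_H e x y (U :&: Ny) \subset suppliers r U.
    apply/fintype.subsetP => u; rewrite in_setU1 nbr_HE // => /orP[/eqP->|].
      by apply/suppliersP; exists v; rewrite /r ?eqxx //; case/setIP: vUN.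
    case/andP => uNx /exists_inP[w /setIP[wU _] euw].
    by apply/suppliersP; exists w; rewrite // /r uNx euw orbT.
  move=> /(sum_subset a) le_a; apply: leq_trans le_a.
  have xNU : x \notin nbr_H e x y (U :&: Ny) by rewrite nbr_HE // (negbTE xNx).
  rewrite big_setU1 //= {1}/a eqxx addnC leq_add2l -sum_nat_const leq_eqVlt.
  apply/orP; left; apply/eqP/eq_bigr => u; rewrite nbr_HE // => /andP[uNx _].
  by rewrite /a uNx; case: eqP uNx xNx => // -> ->.
have [g [g_r g_a g_b]] := transport_hall hall.
have dxN0 : dx%:R != 0 :> R by rewrite pnatr_eq0 -lt0n.
have dyN0 : dy%:R != 0 :> R by rewrite pnatr_eq0 -lt0n.
pose mu := lazy_measure e alpha x; pose nu := lazy_measure e alpha y.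
pose s : R := (1 - alpha) / (dx%:R * dy%:R).
pose q : R := (1 - alpha) / dy%:R.
pose row u : R := s * (\sum_v g u v)%:R.
pose h u : R := mu u - row u - (if u == x then q else 0).
pose pi u v : R := s * (g u v)%:R + (if v == y then h u else 0)
  + (if (u == x) && (v == x) then q else 0).
have s_ge0 : 0 <= s by rewrite divr_ge0 ?mulr_ge0 ?subr_ge0.
have q_ge0 : 0 <= q by rewrite divr_ge0 ?subr_ge0.
have bNy v : v \notin Ny -> b v = 0%N by rewrite /b => /negbTE ->.
have g0 u v : v \notin Ny -> g u v = 0%N.
  move/bNy => bv0; apply/eqP; rewrite -leqn0 -bv0 -g_b.
  by rewrite (bigD1 u) //= leq_addr.
have xNy : x \notin Ny by rewrite inNy eqxx.
have yNy : y \notin Ny by rewrite inNy e_irr andbF.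
have sum_g : (\sum_u \sum_v g u v = #|Ny| * dx)%N.
  rewrite exchange_big /=; under eq_bigr do rewrite g_b.
  by rewrite /b -big_mkcond /= sum_nat_const.
have sum_row : \sum_u row u = 1 - alpha - q.
  rewrite -mulr_sumr -natr_sum sum_g natrM /s /q.
  have -> : #|Ny|%:R = dy%:R - 1 :> R by rewrite -card_Ny -natr1 addrK.
  by field; apply/andP.
have sum_mass z : (0 < degree e z)%N -> \sum_u lazy_measure e alpha z u = 1 :> R.
  move=> dz_gt0; under eq_bigr do rewrite -[lazy_measure _ _ _ _]mul1r.
  rewrite (sum_lazy_measure e_irr (fun=> 1)) sumr_const mul1r -/(degree e z).
  by field; rewrite pnatr_eq0 -lt0n.
(* At [x] this uses [alpha >= 1/2]: the flow out of [x] is at most [1 - alpha - q], which leaves at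
   least [2 * alpha - 1]. At a vertex of [Nx], the supply bound [dy] is its whole mass. *)
have h_ge0 u : 0 <= h u.
  rewrite /h /row /mu /lazy_measure; have [->|ux] := eqVneq u x.
    have : s * (\sum_v g x v)%:R <= 1 - alpha - q.
      rewrite -sum_row [leRHS](bigD1 x) //= lerDl sumr_ge0 // => i _.
      by rewrite mulr_ge0.
    by move: alpha_ge; lra.
  have := g_a u; rewrite /a (negbTE ux) inNx subr0.
  case: (e x u) => /=; last by rewrite andbF leqn0 => /eqP ->; rewrite mulr0 subr0.
  move=> g_dy; have {}g_dy : (\sum_v g u v <= dy)%N.
    by apply: leq_trans g_dy _; case: eqP.
  rewrite subr_ge0; apply: (@le_trans _ _ (s * dy%:R)).
    by rewrite ler_wpM2l // ler_nat.
  by rewrite (_ : s * dy%:R = (1 - alpha) / dx%:R) // /s; field; apply/andP.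
have pi_ge0 u v : 0 <= pi u v.
  rewrite /pi; apply: addr_ge0; last by case: (_ && _).
  by apply: addr_ge0; [rewrite mulr_ge0|case: (v == y)].
have pi_mu u : \sum_v pi u v = mu u.
  rewrite /pi !big_split /= -mulr_sumr -natr_sum -/(row u) -[X in _ + X + _]big_mkcond.
  rewrite (@big_pred1_eq _ _ _ _ y).
  rewrite (eq_bigr (fun v => if v == x then if u == x then q else 0 else 0)).
    by rewrite -big_mkcond big_pred1_eq /h; ring.
  by move=> v _; case: (u == x); case: (v == x).
have pi_nuN v : v != y -> \sum_u pi u v = nu v.
  move=> vy; rewrite /pi !big_split /= -mulr_sumr -natr_sum g_b (negbTE vy) big1_eq addr0.
  rewrite -big_mkcondr /= /nu /lazy_measure (negbTE vy).
  rewrite /b inNy; have [->|vx] /= := eqVneq v x.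
    by rewrite mulr0 add0r eyx; under eq_bigl do rewrite andbT; rewrite big_pred1_eq.
  rewrite big_pred0 ?addr0 => [|u]; last by rewrite andbF.
  by case: ifP => _; rewrite ?mulr0 // /s -/dy; field; apply/andP.
(* The column of [y] follows from the others, since both measures have total mass 1. *)
have pi_nu v : \sum_u pi u v = nu v.
  have [->|] := eqVneq v y; last exact: pi_nuN.
  have total : \sum_v \sum_u pi u v = \sum_v nu v.
    rewrite exchange_big /=; under eq_bigr do rewrite pi_mu.
    by rewrite !sum_mass.
  move: total; rewrite [LHS](bigD1 y) //= [RHS](bigD1 y) //=.
  by rewrite [X in _ + X = _](eq_bigr nu pi_nuN) => /addIr.
have coupled : coupling mu nu pi.
  split=> // u v; rewrite pi_ge0 /= -(sum_mass x) // -/mu.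
  have le_sum (f : T -> R) z : (forall w, 0 <= f w) -> f z <= \sum_w f w.
    by move=> f_ge0; rewrite (bigD1 z) //= lerDl sumr_ge0.
  have mu_ge0 w : 0 <= mu w by rewrite -pi_mu sumr_ge0.
  apply: le_trans (le_sum mu u mu_ge0).
  by rewrite -pi_mu; apply: (le_sum (pi u)).
apply: le_trans (ereal_inf_lbound _) _; first by exists pi.
(* An upper bound for the distance on the pairs that carry mass: the value 2 comes from walks
   through [x] when the target is [y], and through [y] when the source is [x]. *)
pose c u v : R := if v == y then (if u == y then 0 else if u == x then 1 else 2)
  else if u == x then (if v == x then 0 else 2) else 1.
apply: le_trans (transport_cost_le (c := c) pi_ge0 _) _.
  move=> u v piN0; rewrite /c.
  have g_edge : v != y -> ~~ ((u == x) && (v == x)) -> (u == x) && (v \in Ny) || e u v.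
    move=> vy uvx; move: piN0; rewrite /pi (negbTE vy) (negbTE uvx) !addr0.
    rewrite mulf_eq0 negb_or pnatr_eq0 -lt0n => /andP[_ g_gt0].
    have vNy : v \in Ny by apply: contraLR g_gt0 => /(g0 u) ->.
    rewrite vNy andbT; case/orP: (g_r _ _ g_gt0) => [->//|/andP[_ ->]].
    by rewrite orbT.
  have dist2 w t z : e w t -> e t z -> (graph_dist R e w z <= 2%:E)%E.
    move=> ewt etz; apply: (@graph_dist_le_path R _ e w [:: t; z]).
    by rewrite /= ewt etz.
  have dist1 w z : e w z -> (graph_dist R e w z <= 1%:E)%E.
    by move=> ewz; apply: (@graph_dist_le_path R _ e w [:: z]); rewrite /= ewz.
  have dist0 w : (graph_dist R e w w <= 0%:E)%E.
    exact: (@graph_dist_le_path R _ e w [::]).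
  have [vy|vy] := eqVneq v y.
    rewrite vy; have [->|uy] := eqVneq u y; first exact: dist0.
    have [->|ux] := eqVneq u x; first exact: dist1.
    (* A vertex other than [x] and not adjacent to it has neither mass nor supply, hence sends
       nothing to [y]. *)
    apply: (dist2 _ x); rewrite // e_sym; apply: contraNT piN0 => exu.
    rewrite /pi /h vy eqxx g0 // (negbTE ux) /= mulr0 /row /mu /lazy_measure.
    rewrite (negbTE ux) (negbTE exu).
    have : (\sum_v g u v == 0)%N.
      by have := g_a u; rewrite /a (negbTE ux) inNx (negbTE exu) andbF leqn0.
    by move/eqP->; rewrite mulr0 !subr0 !addr0.
  have := g_edge vy; have [->|ux] /= := eqVneq u x; last first.
    by move=> /(_ isT) /dist1.
  have [->|vx] := eqVneq v x; first by move=> _; exact: dist0.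
  move=> /(_ isT); rewrite inNy vx /= => /orP[eyv|/dist1].
    exact: (dist2 _ y).
  by move/le_trans; apply; rewrite lee_fin ler1n.
rewrite lee_fin.
(* Flow costs 1 per unit along an edge and 2 from [x], the remainder [h] pays the distance to [y],
   and the mass [q] kept at [x] is free. *)
have c_pi u v : c u v * pi u v = s * (g u v)%:R * (if u == x then 2 else 1)
   + (if v == y then (if u == y then 0 else if u == x then 1 else 2) * h u else 0).
  rewrite /c /pi; have [->|vy] := eqVneq v y.
    by rewrite g0 // (negbTE (_ : y != x)) 1?eq_sym // andbF; ring.
  have [->|ux] := eqVneq u x; last by rewrite /=; ring.
  by have [->|vx] := eqVneq v x; [rewrite g0 //=|rewrite /=]; ring.
under eq_bigr do
  (under eq_bigr do rewrite c_pi;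
   rewrite big_split /= -mulr_suml -mulr_sumr -natr_sum -/(row _);
   rewrite -big_mkcond big_pred1_eq).
rewrite big_split /=.
have at_pt z (f : T -> R) : f z = \sum_u (if u == z then f u else 0).
  by rewrite -big_mkcond big_pred1_eq.
have -> : \sum_u row u * (if u == x then 2 else 1) = 1 - alpha - q + row x.
  rewrite -sum_row (at_pt x row) -big_split.
  by apply: eq_bigr => u _ /=; case: (u == x); ring.
have sum_h : \sum_u h u = alpha.
  rewrite /h !sumrB sum_mass // sum_row -big_mkcond big_pred1_eq; ring.
have -> : \sum_u (if u == y then 0 else if u == x then 1 else 2) * h u
    = 2 * alpha - h x - 2 * h y.
  rewrite -sum_h (at_pt x h) (at_pt y h) !mulr_sumr -!sumrB.
  apply: eq_bigr => u _ /=.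
  by have [->|_] := eqVneq u y; [rewrite [y == x]eq_sym (negbTE xy)|case: (u == x)]; ring.
have row_y : row y = 0.
  have := g_a y; rewrite /a eq_sym (negbTE xy) inNx eqxx /= leqn0 /row => /eqP->.
  exact: mulr0.
have row_x : row x <= s * D%:R.
  by rewrite ler_wpM2l // ler_nat; have := g_a x; rewrite /a eqxx.
have hx : h x = alpha - row x - q by rewrite /h /mu /lazy_measure eqxx.
have hy : h y = (1 - alpha) / dx%:R.
  by rewrite /h row_y /mu /lazy_measure eq_sym (negbTE xy) exy !subr0.
(* The accumulated cost equals [1 - 2 * h y + 2 * row x], where [h y] is the mass that stays at [y];
   [row_x] then bounds the flow out of [x]. *)
have -> : 1 - 2 * (1 - alpha) * (dx%:R^-1 - D%:R / (dx%:R * dy%:R))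
    = 1 - 2 * h y + 2 * (s * D%:R).
  by rewrite hy /s; field; apply/andP.
by rewrite hx; lra.
Qed.

End EdgeBounds.

(** * The curvature formula: matching the two bounds and passing to the limit *)

Theorem lemma3p1 (R : realType) (T : finType) (e : rel T)
    (e_sym : symmetric e) (e_irr : irreflexive e) (e_bip : bipartite e)
    (x y : T) (exy : e x y) :
  cvg (kappa_ratio e x y alpha @[alpha --> (1 : R)^'-]) /\
  kappa_LLY R e x y =
    (2%:E * \big[mine/+oo]_(U : {set T} | U \subset nbr_minus e y x)
      ((#|nbr_H e x y U| + 1)%:R / (degree e x)%:R
        - #|U|%:R / (degree e y)%:R)%:E)%E.
Proof.
have [A eA] := e_bip.
set dx := degree e x; set dy := degree e y.
pose val (U : {set T}) : R := (#|nbr_H e x y U| + 1)%:R / dx%:R - #|U|%:R / dy%:R.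
have dx_gt0 : 0 < dx%:R :> R by rewrite ltr0n (degree_gt0 exy).
have dy_gt0 : 0 < dy%:R :> R by rewrite ltr0n (@degree_gt0 _ _ y x) // e_sym.
have dxN0 := lt0r_neq0 dx_gt0; have dyN0 := lt0r_neq0 dy_gt0.
have s0N : finset.set0 \subset nbr_minus e y x by apply: finset.sub0set.
have val0 : val finset.set0 = dx%:R^-1.
  have N0 : nbr_H e x y finset.set0 = finset.set0.
    apply/setP => u; rewrite inE finset.in_set0; apply/negP => /andP[_].
    by case/exists_inP => v; rewrite finset.in_set0.
  by rewrite /val N0 cards0 mul0r subr0 add0n mul1r.
(* The minimum is attained: the empty set is admissible and every value lies below the initial
   [+oo]. *)
have [U0 sU0 minE] := @eq_bigmin _ _ _ (+oo%E : \bar R) finset.set0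
  (fun U : {set T} => U \subset nbr_minus e y x) (fun U => (val U)%:E) s0N (fun U _ => leey _).
have val_min (U : {set T}) : U \subset nbr_minus e y x -> val U0 <= val U.
  move=> sU; have := @bigmin_le_cond _ _ _ (+oo%E : \bar R) U
    (fun U : {set T} => U \subset nbr_minus e y x) (fun U => (val U)%:E) sU.
  by rewrite minE lee_fin.
rewrite minE.
(* Minimising [val] amounts to maximising the excess of demand over supply, so [D] is the largest
   deficiency. Comparison with the empty set ([leU0]) shows that the truncated subtraction loses
   nothing. *)
pose D := (#|U0| * dx - #|nbr_H e x y U0| * dy)%N.
have valE U : val U = dx%:R^-1
    - ((#|U| * dx)%:R - (#|nbr_H e x y U| * dy)%:R) / (dx%:R * dy%:R).
  by rewrite /val natrD !natrM; field; apply/andP.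
have val_le U V : (val U <= val V) = ((#|V| * dx)%:R - (#|nbr_H e x y V| * dy)%:R
    <= (#|U| * dx)%:R - (#|nbr_H e x y U| * dy)%:R :> R).
  by rewrite !valE lerD2l lerN2 ler_pM2r // invr_gt0 mulr_gt0.
have leU0 : (#|nbr_H e x y U0| * dy <= #|U0| * dx)%N.
  have := val_min _ s0N; rewrite val0 valE gerBl.
  by rewrite pmulr_lge0 ?invr_gt0 ?mulr_gt0 // subr_ge0 ler_nat.
have deficient (U : {set T}) : U \subset nbr_minus e y x ->
    (#|U| * dx <= #|nbr_H e x y U| * dy + D)%N.
  move/val_min; rewrite val_le -(natrB _ leU0) -/D lerBlDl -natrD ler_nat.
  by [].
have ratioE : \forall alpha \near (1 : R)^'-,
    kappa_ratio e x y alpha = (2%:E * (val U0)%:E)%E.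
  near=> alpha.
  have alpha_lt1 : alpha < 1 by near: alpha; exact: nbhs_left_lt.
  have alpha_ge : 2^-1 <= alpha.
    by near: alpha; apply: nbhs_left_ge; rewrite invf_lt1 ?ltr1n.
  have W : wasserstein e (lazy_measure e alpha x) (lazy_measure e alpha y)
      = (1 - 2 * (1 - alpha) * val U0)%:E.
    apply/eqP; rewrite eq_le (wasserstein_ge_cut e_sym e_irr eA exy) // andbT.
    (* By [valE], [val U0] is [1/dx - D/(dx * dy)], so the flow bound meets the cut bound at
       [U0]. *)
    have := wasserstein_le_deficiency e_sym e_irr exy alpha_ge (ltW alpha_lt1) deficient.
    by rewrite valE /D natrB.
  rewrite /kappa_ratio /kappa W -EFinB -!EFinM; congr EFin.
  by field; rewrite subr_eq0 gt_eqF.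
split; first exact: is_cvg_near_cst ratioE.
by rewrite /kappa_LLY; apply: lim_near_cst ratioE.
Unshelve. all: by end_near.
Qed.
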